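(* Let $p>0$ be a prime and let $R$ be the convolution ring in characteristic $p$. The affine scheme $\mathrm{Spec}(R)$ contains infinitely many irreducible components. In particular, the ring $R$ is not noetherian.
   Context: The convolution ring $R$ in characteristic $p$: let $k$ be a field of characteristic $p$ and consider the category of pairs $(V,\varphi)$, where $V$ is a finite-dimensional $k$-vector space and $\varphi$ is a nilpotent endomorphism. $R$ is the free abelian group on isomorphism classes of such pairs modulo the relations $[V]=[V']+[V'']$ coming from direct sum decompositions $V\simeq V'\oplus V''$. As an abelian group it is free on the classes $f_n$, $n\geq 1$, of $k^n$ with the nilpotent Jordan block $J_n$ of size $n$. Multiplication is induced by sending $(V,\varphi),(V',\varphi')$ to $V\otimes_k V'$ with the endomorphism $\varphi\otimes\mathrm{id}+\mathrm{id}\otimes\varphi'$. This makes $R$ a commutative ring with unit $f_1=1$, depending only on $p$. *)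

(* Defs.v *)
From HB Require Import structures.
From mathcomp Require Import all_boot all_order all_algebra.
From mathcomp Require Import boolp classical_sets cardinality topology_structure.
From mathcomp Require Import mxtens monalg.

Set Implicit Arguments.
Unset Strict Implicit.
Unset Printing Implicit Defensive.

Import GRing.Theory.

Local Open Scope ring_scope.
Local Open Scope quotient_scope.

(* The objects (V, phi), with V = k^n (every finite-dimensional space is
   isomorphic to some k^n) and phi acting on row vectors by v |-> v *m A. *)
Record nilpEndo (k : fieldType) := NilpEndo {
  ne_dim : nat;
  ne_mx :> 'M[k]_ne_dim;
  ne_nilp : exists n, ne_mx ^+ n = 0 }.

HB.instance Definition _ k := gen_eqMixin (nilpEndo k).
HB.instance Definition _ k := gen_choiceMixin (nilpEndo k).

Section Objects.
Variable k : fieldType.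
Implicit Types V W U : nilpEndo k.

Definition ne_iso V W : Prop :=
  exists (P : 'M_(ne_dim V, ne_dim W)) (Q : 'M_(ne_dim W, ne_dim V)),
    [/\ P *m Q = 1%:M, Q *m P = 1%:M & V *m P = P *m W].

Lemma ne_iso_refl V : ne_iso V V.
Proof. by exists 1%:M, 1%:M; rewrite !mulmx1 mul1mx. Qed.

Lemma ne_iso_sym V W : ne_iso V W -> ne_iso W V.
Proof.
case=> P [Q [PQ QP H]]; exists Q, P; split=> //.
by rewrite -[LHS]mul1mx -QP -!mulmxA [P *m _]mulmxA -H -!mulmxA PQ mulmx1.
Qed.

Lemma ne_iso_trans V W U : ne_iso V W -> ne_iso W U -> ne_iso V U.
Proof.
case=> P [Q [PQ QP H]] [P' [Q' [PQ' QP' H']]].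
exists (P *m P'), (Q' *m Q); split.
- by rewrite -mulmxA [P' *m _]mulmxA PQ' mul1mx.
- by rewrite -mulmxA [Q *m _]mulmxA QP mul1mx.
- by rewrite mulmxA H -mulmxA H' mulmxA.
Qed.

Lemma ne_iso_dim V W : ne_iso V W -> ne_dim V = ne_dim W.
Proof.
by case=> P [Q [PQ QP _]]; apply/eqP; rewrite eqn_leq (mulmx1_min PQ) (mulmx1_min QP).
Qed.

Lemma ne_iso_bij V W (f : 'I_(ne_dim V) -> 'I_(ne_dim W)) g :
  cancel f g -> cancel g f -> (forall i j, V i j = W (f i) (f j)) -> ne_iso V W.
Proof.
move=> fK gK H.
exists (\matrix_(i, j) (f i == j)%:R), (\matrix_(i, j) (f j == i)%:R); split.
- apply/matrixP=> i j; rewrite !mxE (bigD1 (f i)) //= big1 ?addr0.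
    by rewrite !mxE eqxx mul1r (can_eq fK) eq_sym.
  by move=> l /negPf nl; rewrite !mxE eq_sym nl mul0r.
- apply/matrixP=> i j; rewrite !mxE (bigD1 (g i)) //= big1 ?addr0.
    by rewrite !mxE gK eqxx mul1r.
  move=> l /negPf nl; rewrite !mxE -(can_eq gK) fK nl mul0r //.
- apply/matrixP=> i j; rewrite !mxE (bigD1 (g j)) //= big1 ?addr0.
    rewrite (bigD1 (f i)) //= big1 ?addr0.
      by rewrite !mxE gK !eqxx mul1r mulr1 H gK.
    by move=> l /negPf nl; rewrite !mxE eq_sym nl mul0r.
  by move=> l /negPf nl; rewrite !mxE -(can_eq gK) fK nl mulr0.
Qed.

Lemma unit_nilp : exists n, (0 : 'M[k]_1) ^+ n = 0.
Proof. by exists 1%N; rewrite expr1. Qed.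
Definition ne_one := NilpEndo unit_nilp.

Lemma dsum_nilp V W : exists n, (block_mx V 0 0 W : 'M_(_ + _)) ^+ n = 0.
Proof.
have E n : (block_mx V 0 0 W : 'M_(_ + _)) ^+ n = block_mx (ne_mx V ^+ n) 0 0 (ne_mx W ^+ n).
  elim: n => [|n IH]; first by rewrite !expr0 -scalar_mx_block.
  by rewrite !exprS IH -!mulmxE mulmx_block !(mulmx0, mul0mx) !(addr0, add0r).
case: (ne_nilp V) (ne_nilp W) => a Ha [b Hb]; exists (a + b)%N.
by rewrite E !exprD Ha Hb mul0r mulr0 block_mx0.
Qed.
Definition ne_dsum V W := NilpEndo (dsum_nilp V W).

Definition tens_mx V W : 'M[k]_(ne_dim V * ne_dim W) :=
  tensmx V 1%:M + tensmx 1%:M W.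

Lemma tens_nilp V W : exists n, tens_mx V W ^+ n = 0.
Proof.
have E m n (A : 'M[k]_m) (B : 'M[k]_n) i : (tensmx A B) ^+ i = tensmx (A ^+ i) (B ^+ i).
  elim: i => [|i IH]; last by rewrite !exprS IH -mulmxE tensmx_mul !mulmxE.
  apply/matrixP=> i j; rewrite !mxE -natrM mulnb.
  case: (mxtens_indexP i) (mxtens_indexP j) => a b [c d].
  by rewrite (can_eq (@mxtens_indexK _ _)) !mxtens_indexK.
case: (ne_nilp V) (ne_nilp W) => a Ha [b Hb]; exists (a + b)%N.
rewrite exprDn_comm; last by rewrite /GRing.comm -!mulmxE !tensmx_mul !mulmx1 !mul1mx.
apply: big1 => i _; rewrite !E !expr1n.
have [ia|ai] := leqP i b.
  rewrite -(subnK (_ : a <= a + b - i)%N) ?exprD ?Ha ?mulr0 ?tens0mx ?mul0r ?mul0rn //.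
  by rewrite -addnBA // leq_addr.
by rewrite -(subnK (ltnW ai)) exprD Hb mulr0 tensmx0 mulr0 mul0rn.
Qed.
Definition ne_tens V W := NilpEndo (tens_nilp V W).

Lemma tens_mxE V W i j i' j' :
  tens_mx V W (mxtens_index (i, j)) (mxtens_index (i', j')) =
  V i i' * (j == j')%:R + (i == i')%:R * W j j'.
Proof. by rewrite mxE !tensmxE !mxE. Qed.

Lemma ne_tensC V W : ne_iso (ne_tens V W) (ne_tens W V).
Proof.
pose sw m n (r : 'I_(m * n)) : 'I_(n * m) :=
  let ij := mxtens_unindex r in mxtens_index (ij.2, ij.1).
have swK m n : cancel (sw m n) (sw n m).
  by move=> r; case: (mxtens_indexP r) => i j; rewrite /sw !mxtens_indexK.
apply: (@ne_iso_bij (ne_tens V W) (ne_tens W V) _ _ (swK _ _) (swK _ _)) => /= r s.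
case: (mxtens_indexP r) (mxtens_indexP s) => i j [i' j'].
by rewrite /sw !mxtens_indexK !tens_mxE addrC mulrC [_ * V _ _]mulrC.
Qed.

Lemma ne_tensA V W U :
  ne_iso (ne_tens V (ne_tens W U)) (ne_tens (ne_tens V W) U).
Proof.
pose f m n l (r : 'I_(m * (n * l))) : 'I_(m * n * l) :=
  let ij := mxtens_unindex r in let jl := mxtens_unindex ij.2 in
  mxtens_index (mxtens_index (ij.1, jl.1), jl.2).
pose g m n l (r : 'I_(m * n * l)) : 'I_(m * (n * l)) :=
  let ij := mxtens_unindex r in let jl := mxtens_unindex ij.1 in
  mxtens_index (jl.1, mxtens_index (jl.2, ij.2)).
apply: (@ne_iso_bij (ne_tens V (ne_tens W U)) (ne_tens (ne_tens V W) U)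
  (f _ _ _) (g _ _ _)) => /=.
- move=> r; case: (mxtens_indexP r) => i s; case: (mxtens_indexP s) => j l.
  by rewrite /f /g !mxtens_indexK.
- move=> r; case: (mxtens_indexP r) => s l; case: (mxtens_indexP s) => i j.
  by rewrite /f /g !mxtens_indexK.
move=> r r'; case: (mxtens_indexP r) => i s; case: (mxtens_indexP s) => j l.
case: (mxtens_indexP r') => i' s'; case: (mxtens_indexP s') => j' l'.
rewrite /f !mxtens_indexK [LHS](@tens_mxE V (ne_tens W U) _ _ _ _).
rewrite [RHS](@tens_mxE (ne_tens V W) U _ _ _ _) /= !tens_mxE.
rewrite !(can_eq (@mxtens_indexK _ _)) !xpair_eqE.
by rewrite -!mulnb !natrM mulrDr mulrDl !mulrA addrA.
Qed.

Lemma ne_tens1 V : ne_iso (ne_tens ne_one V) V.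
Proof.
pose f n (r : 'I_(1 * n)) : 'I_n := (mxtens_unindex r).2.
pose g n (j : 'I_n) : 'I_(1 * n) := mxtens_index (ord0, j).
apply: (@ne_iso_bij (ne_tens ne_one V) V (f _) (g _)) => /=.
- by move=> r; case: (mxtens_indexP r) => i j; rewrite /f /g mxtens_indexK [i]ord1.
- by move=> j; rewrite /f /g mxtens_indexK.
move=> r s; case: (mxtens_indexP r) (mxtens_indexP s) => i j [i' j'].
rewrite /f !mxtens_indexK [LHS](@tens_mxE ne_one V _ _ _ _) /= mxE mul0r add0r.
by rewrite [i]ord1 [i']ord1 eqxx mul1r.
Qed.

Lemma ne_tensDl V W U :
  ne_iso (ne_tens (ne_dsum V W) U) (ne_dsum (ne_tens V U) (ne_tens W U)).
Proof.
pose f m n l (r : 'I_((m + n) * l)) : 'I_(m * l + n * l) :=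
  let ij := mxtens_unindex r in
  match split ij.1 with
  | inl i => lshift _ (mxtens_index (i, ij.2))
  | inr i => rshift _ (mxtens_index (i, ij.2)) end.
pose g m n l (r : 'I_(m * l + n * l)) : 'I_((m + n) * l) :=
  match split r with
  | inl s => let ij := mxtens_unindex s in mxtens_index (lshift _ ij.1, ij.2)
  | inr s => let ij := mxtens_unindex s in mxtens_index (rshift _ ij.1, ij.2) end.
have splitl m n (i : 'I_m) : split (lshift n i) = inl i := unsplitK (inl i).
have splitr m n (i : 'I_n) : split (rshift m i) = inr i := unsplitK (inr i).
have fl m n l i j : f m n l (mxtens_index (lshift _ i, j)) = lshift _ (mxtens_index (i, j)).
  by rewrite /f mxtens_indexK /= splitl.
have fr m n l i j : f m n l (mxtens_index (rshift _ i, j)) = rshift _ (mxtens_index (i, j)).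
  by rewrite /f mxtens_indexK /= splitr.
apply: (@ne_iso_bij (ne_tens (ne_dsum V W) U)
  (ne_dsum (ne_tens V U) (ne_tens W U)) (f _ _ _) (g _ _ _)) => /=.
- move=> r; case: (mxtens_indexP r) => i j; case: (split_ordP i) => a ->.
    by rewrite fl /g splitl mxtens_indexK.
  by rewrite fr /g splitr mxtens_indexK.
- move=> r; case: (split_ordP r) => a ->; case: (mxtens_indexP a) => i j.
    by rewrite /g splitl mxtens_indexK fl.
  by rewrite /g splitr mxtens_indexK fr.
move=> r s; case: (mxtens_indexP r) (mxtens_indexP s) => i j [i' j'].
rewrite [LHS](@tens_mxE (ne_dsum V W) U _ _ _ _) /=.
case: (split_ordP i) => a ->; case: (split_ordP i') => b ->; rewrite ?fl ?fr.
- by rewrite !block_mxEul tens_mxE eq_lshift.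
- by rewrite !block_mxEur !mxE mul0r eq_lrshift mul0r addr0.
- by rewrite !block_mxEdl !mxE mul0r eq_rlshift mul0r addr0.
- by rewrite !block_mxEdr tens_mxE eq_rshift.
Qed.

Lemma ne_tens_iso V V' W W' :
  ne_iso V V' -> ne_iso W W' -> ne_iso (ne_tens V W) (ne_tens V' W').
Proof.
move=> [P [Q [PQ QP H]]] [P' [Q' [PQ' QP' H']]].
have t1 m n : tensmx (1%:M : 'M[k]_m) (1%:M : 'M[k]_n) = 1%:M.
  apply/matrixP=> r s; rewrite !mxE -natrM mulnb.
  case: (mxtens_indexP r) (mxtens_indexP s) => a b [c d].
  by rewrite (can_eq (@mxtens_indexK _ _)) !mxtens_indexK.
exists (tensmx P P'), (tensmx Q Q'); split.
- by rewrite tensmx_mul PQ PQ' t1.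
- by rewrite tensmx_mul QP QP' t1.
by rewrite mulmxDl mulmxDr !tensmx_mul !mul1mx !mulmx1 H H'.
Qed.

Lemma ne_dim1_iso V : ne_dim V = 1%N -> ne_iso V ne_one.
Proof.
case: V => n A /= [e HA] n1; subst n.
have A0 : A = 0.
  have E i : A ^+ i = (A 0 0 ^+ i)%:M.
    elim: i => [|i IH]; first by rewrite !expr0.
    by rewrite !exprS IH {1}[A]mx11_scalar -mulmxE -scalar_mxM.
  move: HA; rewrite E => /matrixP /(_ 0 0); rewrite !mxE eqxx mulr1n => /eqP.
  by rewrite expf_eq0 => /andP[_ /eqP a0]; rewrite [A]mx11_scalar a0 raddf0.
rewrite /ne_iso; exists (1%:M : 'M_1), (1%:M : 'M_1); split; rewrite ?mulmx1 //=.
by rewrite A0 mulmx0.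
Qed.

Definition ne_isob : rel (nilpEndo k) := fun V W => `[< ne_iso V W >].

Lemma ne_isob_equiv : equiv_class_of ne_isob.
Proof.
split=> [V|V W|V W U]; first by apply/asboolP/ne_iso_refl.
  by apply/asboolP/asboolP; apply: ne_iso_sym.
by move=> /asboolP h /asboolP h'; apply/asboolP/(ne_iso_trans h).
Qed.
Canonical ne_isob_equiv_rel := EquivRelPack ne_isob_equiv.

End Objects.

Definition isoClass (k : fieldType) := {eq_quot @ne_isob k}.
HB.instance Definition _ k := Choice.on (isoClass k).
HB.instance Definition _ k := EqQuotient.on (isoClass k).

Section IsoClasses.
Variable k : fieldType.
Implicit Types (V W : nilpEndo k) (x y : isoClass k).

Definition iso_cls V : isoClass k := \pi V.

Lemma iso_clsP V W : iso_cls V = iso_cls W <-> ne_iso V W.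
Proof.
by split=> [/eqquotP/asboolP//|h]; apply/eqquotP/asboolP.
Qed.

Lemma iso_cls_repr x : iso_cls (repr x) = x.
Proof. exact: reprK. Qed.

Definition cls_tens x y := iso_cls (ne_tens (repr x) (repr y)).

Lemma cls_tensE V W : cls_tens (iso_cls V) (iso_cls W) = iso_cls (ne_tens V W).
Proof. by apply/iso_clsP/ne_tens_iso; apply/iso_clsP; rewrite iso_cls_repr. Qed.

Lemma cls_tensC : commutative cls_tens.
Proof. by move=> x y; apply/iso_clsP/ne_tensC. Qed.

Lemma cls_tensA : associative cls_tens.
Proof.
move=> x y z; rewrite -[x]iso_cls_repr -[y]iso_cls_repr -[z]iso_cls_repr.
by rewrite !cls_tensE; apply/iso_clsP/ne_tensA.
Qed.

Lemma cls_tens1l : left_id (iso_cls (ne_one k)) cls_tens.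
Proof.
move=> x; rewrite -[x]iso_cls_repr cls_tensE; exact/iso_clsP/ne_tens1.
Qed.

Lemma cls_tens1r : right_id (iso_cls (ne_one k)) cls_tens.
Proof. by move=> x; rewrite cls_tensC cls_tens1l. Qed.

Lemma cls_tens_unit x y : cls_tens x y = iso_cls (ne_one k) ->
  x = iso_cls (ne_one k) /\ y = iso_cls (ne_one k).
Proof.
move=> /iso_clsP/ne_iso_dim /= /eqP; rewrite muln_eq1 => /andP[/eqP hx /eqP hy].
by rewrite -[x]iso_cls_repr -[y]iso_cls_repr; split; apply/iso_clsP/ne_dim1_iso.
Qed.

HB.instance Definition _ := Choice_isMonomialDef.Build (isoClass k)
  cls_tensA cls_tens1l cls_tens1r cls_tens_unit.
HB.instance Definition _ := MonomialDef_isConomialDef.Build (isoClass k) cls_tensC.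

End IsoClasses.

(* The free abelian group on isomorphism classes; its product as a monoid
   algebra is the biadditive extension of the tensor product of classes. *)
Notation freeIso k := {malg int[isoClass k]}.

Section ConvolutionRing.
Variable k : fieldType.
Implicit Types V W U : nilpEndo k.

Definition dsum_rel V W : freeIso k :=
  << iso_cls (ne_dsum V W) >> - << iso_cls V >> - << iso_cls W >>.

(* The subgroup generated by the relations [V (+) W] = [V] + [W]. *)
Definition dsum_sub : {pred freeIso k} := fun x =>
  `[< forall H : {pred freeIso k},
        zmod_closed H -> (forall V W, dsum_rel V W \in H) -> x \in H >].

Lemma dsum_subP x : reflect (forall H : {pred freeIso k},
    zmod_closed H -> (forall V W, dsum_rel V W \in H) -> x \in H)
  (x \in dsum_sub).
Proof. exact: asboolP. Qed.

Lemma dsum_sub_zmod : zmod_closed dsum_sub.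
Proof.
split=> [|x y /dsum_subP hx /dsum_subP hy]; apply/dsum_subP => H cH rH.
  by case: cH.
by case: (cH) => _; apply; [apply: hx | apply: hy].
Qed.

Lemma dsum_sub_rel V W : dsum_rel V W \in dsum_sub.
Proof. by apply/dsum_subP => H _; apply. Qed.

HB.instance Definition _ := GRing.isZmodClosed.Build _ dsum_sub dsum_sub_zmod.

Lemma freeIsoM (x y : isoClass k) : << x >> * << y >> = << mmul x y >> :> freeIso k.
Proof. by rewrite malgM_def fgmulUU mulr1. Qed.

Lemma dsum_rel_mul V W U :
  dsum_rel V W * << iso_cls U >> = dsum_rel (ne_tens V U) (ne_tens W U).
Proof.
rewrite !mulrBl !freeIsoM /dsum_rel /mmul /= !cls_tensE.
have /iso_clsP-> := ne_tensDl V W U.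
by [].
Qed.

Lemma dsum_sub_mulU x (y : isoClass k) : x \in dsum_sub -> x * << y >> \in dsum_sub.
Proof.
rewrite -[y]iso_cls_repr => /dsum_subP hx.
have [H HE] : exists H : {pred freeIso k}, forall z,
    (z \in H) = (z * << iso_cls (repr y) >> \in dsum_sub).
  by exists (fun z => z * << iso_cls (repr y) >> \in dsum_sub).
rewrite -HE; apply: hx; last first.
  by move=> V W; rewrite HE dsum_rel_mul dsum_sub_rel.
split=> [|u v]; first by rewrite HE mul0r; exact: rpred0.
rewrite HE HE HE => hu hv; rewrite mulrBl; exact: rpredB.
Qed.

Lemma dsum_sub_mul a x : x \in dsum_sub -> a * x \in dsum_sub.
Proof.
move=> hx; rewrite mulrC [a]monalgE mulr_sumr rpred_sum // => y _.
by rewrite -[a@_y]intz raddfMz mulrzAr rpredMz // dsum_sub_mulU.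
Qed.

Definition cls_dim (x : isoClass k) : int := ne_dim (repr x).

Lemma dsum_sub_dim x : x \in dsum_sub -> mmap idfun cls_dim x = 0.
Proof.
move=> /dsum_subP /(_ (fun z => mmap idfun cls_dim z == 0)) h; apply/eqP; apply: h.
  split=> [|u v]; rewrite !unfold_in ?raddf0 // => /eqP hu /eqP hv.
  by rewrite raddfB /= hu hv subrr.
have D V : cls_dim (iso_cls V) = ne_dim V.
  by congr Posz; apply: ne_iso_dim; apply/iso_clsP; rewrite iso_cls_repr.
move=> V W; rewrite unfold_in !raddfB /= !mmapU /= !mul1r !D /=.
by rewrite PoszD addrAC addrK subrr.
Qed.

Lemma dsum_sub1 : 1 \notin dsum_sub.
Proof.
apply/negP=> /dsum_sub_dim; rewrite mmapU /= mul1r /cls_dim => /eqP.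
have /ne_iso_dim -> : ne_iso (repr (iso_cls (ne_one k))) (ne_one k).
  by apply/iso_clsP; rewrite iso_cls_repr.
by [].
Qed.

Lemma dsum_sub_idealr : idealr_closed dsum_sub.
Proof.
split; [exact: rpred0 | exact: dsum_sub1 | move=> a x y hx hy].
by rewrite rpredD // dsum_sub_mul.
Qed.

HB.instance Definition _ := isProperIdeal.Build _ dsum_sub
  (idealr_closed_nontrivial dsum_sub_idealr).

Definition convRing : Type := {ideal_quot dsum_sub}.
HB.instance Definition _ := GRing.ComNzRing.on convRing.

Definition conv_cls V : convRing := \pi_({ideal_quot dsum_sub}) << iso_cls V >>.

Lemma conv_cls_iso V W : ne_iso V W -> conv_cls V = conv_cls W.
Proof. by rewrite /conv_cls => /iso_clsP ->. Qed.

Lemma conv_cls_dsum V W : conv_cls (ne_dsum V W) = conv_cls V + conv_cls W.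
Proof.
rewrite /conv_cls -rmorphD; apply/eqP; rewrite -Quotient.idealrBE.
by rewrite opprD addrA dsum_sub_rel.
Qed.

Lemma conv_cls_tens V W : conv_cls (ne_tens V W) = conv_cls V * conv_cls W.
Proof. by rewrite /conv_cls -rmorphM freeIsoM /mmul /= cls_tensE. Qed.

Lemma conv_cls_one : conv_cls (ne_one k) = 1.
Proof. by rewrite /conv_cls -[RHS](rmorph1 (\pi_({ideal_quot dsum_sub}))). Qed.

End ConvolutionRing.

(* Prime spectrum; [idealr_closed] includes properness (1 \notin S). *)
Record Spec (R : comNzRingType) := MkSpec {
  spec_ideal :> {pred R};
  spec_idealP : idealr_closed spec_ideal;
  spec_primeP : prime_idealr_closed spec_ideal }.

HB.instance Definition _ R := gen_eqMixin (Spec R).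
HB.instance Definition _ R := gen_choiceMixin (Spec R).

Local Open Scope classical_set_scope.

Section Zariski.
Variable R : comNzRingType.

Definition zeroLocus (E : set R) : set (Spec R) :=
  [set P : Spec R | forall x, E x -> x \in P].

Definition zariski_open (U : set (Spec R)) : Prop :=
  exists E, U = ~` zeroLocus E.

Lemma zariski_openT : zariski_open setT.
Proof.
exists setT; rewrite -setC0; congr (~` _); apply/esym/seteqP; split=> // P.
by move=> /(_ 1 I); case: (spec_idealP P) => _ /negP.
Qed.

Lemma zariski_openI : setI_closed zariski_open.
Proof.
move=> _ _ [E ->] [F ->]; exists [set z | exists x y, [/\ E x, F y & z = x * y]].
rewrite -setCU; congr (~` _); apply/seteqP; split=> P.
  have [P0 _ Pm] := spec_idealP P.
  have PM a x : x \in P -> a * x \in P by move=> xP; rewrite -[_ * _]addr0 Pm.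
  by move=> [h|h] _ [x [y [Ex Fy ->]]]; [rewrite mulrC|]; apply: PM; apply: h.
move=> h; apply: contrapT => /not_orP[/existsNP[x /not_implyP[Ex xP]]].
move=> /existsNP[y /not_implyP[Fy yP]].
have /spec_primeP : x * y \in P by apply: h; exists x, y.
by case/orP.
Qed.

Lemma zariski_open_bigU (I : Type) (f : I -> set (Spec R)) :
  (forall i, zariski_open (f i)) -> zariski_open (\bigcup_i f i).
Proof.
move=> /choice[E fE]; exists (\bigcup_i E i).
rewrite (eq_bigcupr (fun i _ => fE i)) -setC_bigcap; congr (~` _).
apply/seteqP; split=> P h.
  by move=> x [i _ Ex]; apply: (h i).
by move=> i _ x Ex; apply: h; exists i.
Qed.

HB.instance Definition _ := isOpenTopological.Build (Spec R)
  zariski_openT zariski_openI zariski_open_bigU.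

Lemma spec_closedP (Z : set (Spec R)) : closed Z <-> exists E, Z = zeroLocus E.
Proof.
rewrite -openC; split=> [[E h]|[E ->]]; last by exists E.
by exists E; rewrite -[LHS]setCK h setCK.
Qed.

End Zariski.

Definition irreducible (T : topologicalType) (Z : set T) : Prop :=
  Z !=set0 /\ forall A B, closed A -> closed B ->
    Z `<=` A `|` B -> Z `<=` A \/ Z `<=` B.

Definition irreducible_component (T : topologicalType) (Z : set T) : Prop :=
  irreducible Z /\ forall Y, irreducible Y -> Z `<=` Y -> Y = Z.

Definition is_ideal (R : comNzRingType) (I : set R) : Prop :=
  I 0 /\ forall a x y, I x -> I y -> I (a * x + y).

Definition noetherian (R : comNzRingType) : Prop :=
  forall I : set R, is_ideal I ->
    exists n (g : 'I_n -> R), I = [set x | exists a, x = \sum_(i < n) a i * g i].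

(* Main.v *)
Require Import Defs.
From mathcomp Require Import all_boot all_order all_algebra.
From mathcomp Require Import boolp classical_sets functions cardinality.
From mathcomp Require Import topology_structure mxtens monalg.

(* Let y n be the class of the Jordan block of size p ^ n.  If the p ^ n-th power
   of the endomorphism of V vanishes, then J_(p^n) (x) V is isomorphic to a sum
   of dim V copies of J_(p^n), so y n * y m = p ^ m y n for m <= n.  Over the
   rationals the y n / p ^ n are therefore a decreasing chain of idempotents, and
   the elements p y n - y n.+1 are pairwise orthogonal.  They are not nilpotent,
   because ranks of powers of the endomorphism are additive invariants.  In any
   commutative ring an infinite orthogonal family of non-nilpotent elements gives
   infinitely many minimal primes (one avoiding each member, hence containing all
   the others) and an ideal that is not finitely generated. *)

Set Implicit Arguments.
Unset Strict Implicit.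
Unset Printing Implicit Defensive.

Import GRing.Theory.

Local Open Scope ring_scope.
Local Open Scope classical_set_scope.

(** * Minimal primes and irreducible components of a commutative ring *)

Section Components.
Variable R : comNzRingType.
Implicit Types (x : R) (P Q : Spec R).

Definition minimal_prime P : Prop :=
  forall Q, {subset Q <= P} -> {subset P <= Q}.

Definition mult_subset (S : set R) : Prop :=
  [/\ S 1, ~ S 0 & forall a b, S a -> S b -> S (a * b)].

(** Zorn is applied to the sets that become multiplicative once the powers of [x] are adjoined, so
    that the empty chain needs no separate treatment. *)
Lemma maximal_mult_subset x : (forall n, x ^+ n <> 0) ->
  exists S, [/\ mult_subset S, S x &
    forall T, mult_subset T -> S `<=` T -> T `<=` S].
Proof.
move=> xN; pose X := [set y | exists n, y = x ^+ n].
have XM a b : X a -> X b -> X (a * b).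
  by move=> [n ->] [m ->]; exists (n + m)%N; rewrite exprD.
have X1 : X 1 by exists 0%N.
have [F FP FC|A [AM Amax]] := @Zorn_bigcup R (fun S => mult_subset (S `|` X)).
  split=> [||a b]; first by right.
    by case=> [[B FB B0]|[n /esym/xN]//]; case: (FP _ FB) => _ + _; apply; left.
  have U B c : F B -> (B `|` X) c -> (\bigcup_(B in F) B `|` X) c.
    by move=> FB [h|h]; [left; exists B|right].
  case=> [[B FB Ba]|Xa] [[C FC' Cb]|Xb]; last by right; exact: XM.
  - have [BC|CB] := FC _ _ FB FC'.
      by apply: (U C) => //; case: (FP _ FC') => _ _; apply; left => //; apply: BC.
    by apply: (U B) => //; case: (FP _ FB) => _ _; apply; left => //; apply: CB.
  - by apply: (U B) => //; case: (FP _ FB) => _ _; apply; [left|right].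
  - by apply: (U C) => //; case: (FP _ FC') => _ _; apply; [right|left].
exists (A `|` X); split=> // [|T TM AT]; first by right; exists 1%N.
apply: contrapT => TA; apply: (Amax T).
  split=> [c Ac|TA']; first by apply: AT; left.
  by apply: TA => c /TA'; left.
by rewrite (_ : T `|` X = T) // setUidl // => c Xc; apply: AT; right.
Qed.

Lemma mult_subset_spec P : mult_subset [set y | y \notin P].
Proof.
case: (spec_idealP P) => P0 P1 _; split=> //=; first by rewrite P0.
by move=> a b aP bP; apply/negP => /spec_primeP; rewrite (negPf aP) (negPf bP).
Qed.

(** Without such a relation, the products [s * a ^+ n] would form a multiplicative set avoiding 0
    and strictly larger than [S]. *)
Lemma maximal_mult_absorb (S : set R) : mult_subset S ->
  (forall T, mult_subset T -> S `<=` T -> T `<=` S) ->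
  forall a, ~ S a -> exists s n, S s /\ s * a ^+ n = 0.
Proof.
move=> [S1 S0 SM] Smax a aS; apply: contrapT => H.
apply/aS/(Smax [set y | exists s n, S s /\ y = s * a ^+ n]).
- split; first by exists 1, 0%N; rewrite mulr1.
    by move=> [s [n [Ss h]]]; apply: H; exists s, n.
  move=> _ _ [s [n [Ss ->]]] [t [m [St ->]]].
  by exists (s * t), (n + m)%N; split; [apply: SM|rewrite exprD mulrACA].
- by move=> s Ss; exists s, 0%N; rewrite mulr1.
- by exists 1, 1%N; rewrite mul1r.
Qed.

(** The complement of a maximal multiplicative set through [x] is such a prime: a smaller prime
    would have a larger multiplicative complement. *)
Lemma exists_minimal_prime x : (forall n, x ^+ n <> 0) ->
  exists P, minimal_prime P /\ x \notin P.
Proof.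
move=> /maximal_mult_subset[S [SM Sx Smax]].
have [S1 S0 Smul] := SM.
have Sabs := maximal_mult_absorb SM Smax.
pose I : pred R := fun y => ~~ `[< S y >].
have IE y : (y \in I) = ~~ `[< S y >] by [].
have IP y : reflect (~ S y) (y \in I) by rewrite IE; exact: asboolPn.
have Iid : idealr_closed I.
  split=> [||a u v /IP/Sabs[s [n [Ss su]]] /IP/Sabs[t [m [St tv]]]].
  - exact/IP.
  - by apply/negP => /IP; apply.
  apply/IP => Suv; apply: S0.
  have SX (w : R) i : S w -> S (w ^+ i).
    by move=> Sw; elim: i => [|i IH]; rewrite ?expr0 // exprS; apply: Smul.
  suff <- : s * t * (a * u + v) ^+ (n + m) = 0 by apply: (Smul _ _ (Smul _ _ Ss St)); apply: SX.
  (* Every binomial term contains [(a * u) ^+ n], killed by [s], or [v ^+ m], killed by [t]. *)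
  rewrite exprDn mulr_sumr big1 // => i _; rewrite mulrnAr.
  have [im|mi] := leqP i m.
    have sau : s * (a * u) ^+ n = 0 by rewrite exprMn mulrCA su mulr0.
    by rewrite -addnBA // exprD -[X in _ * X]mulrA mulrACA sau mul0r mul0rn.
  by rewrite -(subnKC (ltnW mi)) exprD [X in _ * X]mulrCA [s * t]mulrC mulrACA tv mul0r mul0rn.
have Ipr : prime_idealr_closed I.
  move=> u v; rewrite !IE -negb_and; apply: contra => /andP[/asboolP Su /asboolP Sv].
  exact/asboolP/Smul.
exists (MkSpec Iid Ipr); split=> [Q QP y|]; last by rewrite /= IE negbK; apply/asboolP.
move=> /IP yS; apply: contrapT => /negP yQ; apply: yS.
apply: (Smax _ (mult_subset_spec Q)) => // z Sz /=.
by apply/negP => /QP /IP; apply.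
Qed.

(** [P] is a generic point: a closed set through [P] contains the whole locus. *)
Lemma zeroLocus_irreducible P :
  irreducible (zeroLocus [set y | y \in P] : set (Spec R)).
Proof.
split; first by exists P.
have gen A : closed A -> A P -> zeroLocus [set y | y \in P] `<=` A.
  by move=> /spec_closedP[E ->] AP Q PQ y Ey; apply: PQ; apply: AP.
move=> A B Ac Bc AB; have [|AP|BP] := AB P; first by [].
  by left; apply: gen.
by right; apply: gen.
Qed.

(** Irreducibility makes the intersection of the primes in [Y] prime: if it contains [u * v], the
    zero loci of [u] and [v] cover [Y], so one of them contains [Y]. *)
Lemma irreducible_generic (Y : set (Spec R)) : irreducible Y ->
  exists Q, forall y, y \in Q <-> forall P, Y P -> y \in P.
Proof.
move=> [[P0 YP0] Yirr].
pose I : pred R := fun y => `[< forall P, Y P -> y \in P >].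
have IP y : reflect (forall P, Y P -> y \in P) (y \in I) by exact: asboolP.
have Iid : idealr_closed I.
  split=> [||a u v /IP uI /IP vI].
  - by apply/IP => P _; case: (spec_idealP P).
  - by apply/negP => /IP/(_ _ YP0); case: (spec_idealP P0) => _ /negPf->.
  - by apply/IP => P YP; case: (spec_idealP P) => _ _; apply; [apply: uI|apply: vI].
have Ipr : prime_idealr_closed I.
  move=> u v /IP uv; apply/orP.
  have cl (w : R) : closed (zeroLocus [set w] : set (Spec R)).
    by apply/spec_closedP; exists [set w].
  have [|h|h] := Yirr _ _ (cl u) (cl v).
  - by move=> P YP; case/orP: (spec_primeP (uv _ YP)) => h; [left|right] => _ ->.
  - by left; apply/IP => P YP; apply: h.
  - by right; apply/IP => P YP; apply: h.
by exists (MkSpec Iid Ipr) => y; split=> /IP.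
Qed.

(** A larger irreducible [Y] contains the point [P], so the intersection of its primes is a prime
    inside [P], hence [P] itself. *)
Lemma minimal_prime_component P : minimal_prime P ->
  irreducible_component (zeroLocus [set y | y \in P] : set (Spec R)).
Proof.
move=> Pmin; split=> [|Y Yirr PY]; first exact: zeroLocus_irreducible.
apply/seteqP; split=> // Q YQ y /= yP.
have [I IE] := irreducible_generic Yirr.
suff /IE : y \in I by apply.
by apply: Pmin yP => z /IE; apply; apply: PY.
Qed.

Variable e : nat -> R.
Hypothesis e_orth : forall i j, (i < j)%N -> e i * e j = 0.
Hypothesis e_nonnil : forall i n, e i ^+ n <> 0.

Lemma orthogonal_infinite_components :
  infinite_set [set Z : set (Spec R) | irreducible_component Z].
Proof.
have /choice[P PE] := fun i => exists_minimal_prime (@e_nonnil i).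
pose Z i : set (Spec R) := zeroLocus [set y | y \in P i].
have e0 i j : i != j -> e i * e j = 0.
  by case: ltngtP => // h _; [exact: e_orth|rewrite mulrC; exact: e_orth].
have Zinj : injective Z.
  move=> i j ZE; apply/eqP/negPn/negP => ij.
  (* This says that [P i] lies inside [P j]. As [P i] contains [e i * e j = 0], either [e i] is in
     [P i] or [e j] is in [P j]. *)
  have PiPj : Z i (P j) by rewrite ZE.
  have : e i * e j \in P i by rewrite e0 //; case: (spec_idealP (P i)).
  case/spec_primeP/orP=> [|/PiPj]; first by case: (PE i) => _ /negPf->.
  by case: (PE j) => _ /negPf->.
apply: (@sub_infinite_set _ (Z @` setT)).
  by move=> _ [i _ <-]; apply: minimal_prime_component; case: (PE i).
move=> Zfin; apply: infinite_nat.
apply: (@sub_finite_set _ _ (Z @^-1` (Z @` setT))); first exact: preimage_image.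
by apply: finite_preimage => // i j _ _; apply: Zinj.
Qed.

(* The ideal of elements annihilated by almost all e_i is not finitely
   generated: a common bound N for its generators would give e_N ^ 2 = 0. *)
Lemma orthogonal_not_noetherian : ~ noetherian R.
Proof.
pose I := [set y : R | exists N, forall n, (N <= n)%N -> y * e n = 0].
move=> /(_ I)[|m [g IE]].
  split=> [|a y z [N yN] [M zM]]; first by exists 0%N => n _; rewrite mul0r.
  exists (maxn N M) => n; rewrite geq_max => /andP[Nn Mn].
  by rewrite mulrDl -mulrA yN // zM // mulr0 addr0.
have gI i : I (g i).
  rewrite IE; exists (fun j => (j == i)%:R).
  rewrite (bigD1 i) //= eqxx mul1r big1 ?addr0 // => j /negPf->.
  by rewrite mul0r.
have [N gN] := choice gI.
have : I (e (\max_i N i)) by exists (\max_i N i).+1 => n; exact: e_orth.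
rewrite IE => -[a ea]; apply: (@e_nonnil (\max_i N i) 2).
rewrite expr2 {1}ea mulr_suml big1 // => i _.
by rewrite -mulrA gN ?mulr0 // leq_bigmax.
Qed.

End Components.

(** * Ranks of powers as additive invariants *)

Section Rank.
Variable k : fieldType.
Implicit Types V W : nilpEndo k.

Lemma mxrank_expr_iso V W m : ne_iso V W ->
  \rank (ne_mx V ^+ m) = \rank (ne_mx W ^+ m).
Proof.
suff le V' W' : ne_iso V' W' -> (\rank (ne_mx V' ^+ m) <= \rank (ne_mx W' ^+ m))%N.
  by move=> h; apply/eqP; rewrite eqn_leq !le //; apply: ne_iso_sym.
move=> [P [Q [PQ _ VP]]].
have VXP : ne_mx V' ^+ m *m P = P *m ne_mx W' ^+ m.
  elim: m => [|m IH]; first by rewrite !expr0 mul1mx mulmx1.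
  by rewrite exprSr -mulmxE -mulmxA VP mulmxA IH -mulmxA mulmxE -exprSr.
rewrite -[ne_mx V' ^+ m]mulmx1 -PQ mulmxA VXP.
by apply: leq_trans (mxrankM_maxl _ _) _; apply: mxrankM_maxr.
Qed.

Lemma mxrank_expr_dsum V W m :
  \rank (ne_mx (ne_dsum V W) ^+ m) = (\rank (ne_mx V ^+ m) + \rank (ne_mx W ^+ m))%N.
Proof.
rewrite -rank_diag_block_mx; congr (\rank _).
elim: m => [|m IH]; first by rewrite !expr0 -scalar_mx_block.
by rewrite !exprS IH -!mulmxE /= mulmx_block !(mulmx0, mul0mx) !(addr0, add0r).
Qed.

Definition cls_rank m (x : isoClass k) : int := \rank (ne_mx (repr x) ^+ m).

Lemma cls_rankE m V : cls_rank m (iso_cls V) = \rank (ne_mx V ^+ m).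
Proof. by congr Posz; apply/mxrank_expr_iso/iso_clsP; rewrite iso_cls_repr. Qed.

Lemma dsum_sub_rank m x : x \in @dsum_sub k -> mmap idfun (cls_rank m) x = 0.
Proof.
move=> /dsum_subP /(_ (fun z => mmap idfun (cls_rank m) z == 0)) h.
apply/eqP/h => [|V W].
  split=> [|u v]; rewrite !unfold_in ?raddf0 // => /eqP hu /eqP hv.
  by rewrite raddfB /= hu hv subrr.
rewrite unfold_in !raddfB /= !mmapU /= !mul1r !cls_rankE mxrank_expr_dsum.
by rewrite PoszD addrAC addrK subrr.
Qed.

(** Ranks descend to [convRing k], where they serve to refute equalities between multiples of
    classes. *)
Lemma conv_cls_rank m V W a b : conv_cls V *+ a = conv_cls W *+ b ->
  (\rank (ne_mx V ^+ m) * a = \rank (ne_mx W ^+ m) * b)%N.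
Proof.
rewrite /conv_cls -!rmorphMn => /eqP; rewrite -Quotient.idealrBE.
move=> /(dsum_sub_rank m)/eqP; rewrite raddfB !raddfMn /= !mmapU /= !mul1r.
rewrite !cls_rankE mulNrn subr_eq0.
have E (c d : nat) : c%:Z *+ d = (c * d)%N by rewrite -mulr_natr natz.
by rewrite !E => /eqP[].
Qed.

End Rank.

(** * Jordan blocks and their tensor products *)

Section Jordan.
Variable k : fieldType.

Definition jordan_mx q : 'M[k]_q := \matrix_(i, j) (i.+1 == j :> nat)%:R.

Lemma jordan_mulE q n (M : 'M[k]_(q, n)) (i i' : 'I_q) j :
  i.+1 = i' -> (jordan_mx q *m M) i j = M i' j.
Proof.
move=> ii'; rewrite !mxE (bigD1 i') //= mxE ii' eqxx mul1r big1 ?addr0 // => l.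
by rewrite mxE ii' eq_sym -val_eqE => /negPf->; rewrite mul0r.
Qed.

Lemma jordan_mul_last q n (M : 'M[k]_(q, n)) (i : 'I_q) j :
  i.+1 = q -> (jordan_mx q *m M) i j = 0.
Proof.
move=> iq; rewrite !mxE big1 // => l _; rewrite mxE iq.
by rewrite gtn_eqF // mul0r.
Qed.

Lemma mul_jordan0 q n (M : 'M[k]_(n, q)) i (j : 'I_q) :
  j = 0%N :> nat -> (M *m jordan_mx q) i j = 0.
Proof. by move=> j0; rewrite !mxE big1 // => l _; rewrite mxE j0 mulr0. Qed.

Lemma mul_jordanE q n (M : 'M[k]_(n, q)) i (j j' : 'I_q) :
  j'.+1 = j -> (M *m jordan_mx q) i j = M i j'.
Proof.
move=> jj'; rewrite !mxE (bigD1 j') //= mxE jj' eqxx mulr1 big1 ?addr0 // => l.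
by rewrite mxE -jj' eqSS -val_eqE => /negPf->; rewrite mulr0.
Qed.

Lemma jordan_exprE q m i j : (jordan_mx q ^+ m) i j = (i + m == j)%N%:R.
Proof.
elim: m i => [|m IH] i; first by rewrite addn0 mxE.
rewrite exprS -mulmxE; case: (ltngtP i.+1 q) (ltn_ord i) => // [iq|iq] _.
  by rewrite (@jordan_mulE _ _ _ i (Ordinal iq)) // IH addSnnS.
by rewrite jordan_mul_last // addnS -addSn iq gtn_eqF // ltn_addr.
Qed.

Lemma jordan_expr0 q : jordan_mx q ^+ q = 0.
Proof.
by apply/matrixP => i j; rewrite jordan_exprE mxE gtn_eqF // ltn_addl.
Qed.

Lemma jordan_nilp q : exists n, jordan_mx q ^+ n = 0.
Proof. by exists q; exact: jordan_expr0. Qed.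

Definition jordan q := NilpEndo (jordan_nilp q).

Lemma zero_nilp n : exists m, (0 : 'M[k]_n) ^+ m = 0.
Proof. by exists 1%N. Qed.

(** Tensoring with [ne_zero n] stands for an [n]-fold direct sum. *)
Definition ne_zero n := NilpEndo (zero_nilp n).

Lemma conv_cls_zero n : conv_cls (ne_zero n) = n%:R.
Proof.
have D a b : conv_cls (ne_zero (a + b)) = conv_cls (ne_zero a) + conv_cls (ne_zero b).
  rewrite -conv_cls_dsum; apply: conv_cls_iso.
  rewrite /ne_iso; exists (1%:M : 'M_(a + b)), (1%:M : 'M_(a + b)).
  by split; rewrite ?mul1mx //= mulmx1 block_mx0.
have E0 : conv_cls (ne_zero 0) = 0 by apply: (addrI (conv_cls (ne_zero 0))); rewrite -D addr0.
elim: n => // n IH; rewrite -addn1 D IH natrD; congr (_ + _).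
by rewrite -[RHS]conv_cls_one; apply/conv_cls_iso/ne_dim1_iso.
Qed.

(* The matrix of the divided derivative (d/dt)^m / m! in the basis 1, t, ... of
   k[t]/(t^q), on which the Jordan block acts as multiplication by t. *)
Definition divder q m : 'M[k]_q := \matrix_(i, l) ('C(i, l) * (l + m == i))%N%:R.

Lemma divder0 q : divder q 0 = 1%:M.
Proof.
apply/matrixP => i l; rewrite !mxE addn0 val_eqE [i == l]eq_sym.
by case: eqP => [->|_]; rewrite ?binn ?muln0.
Qed.

(** Leibniz rule [D_(m+1) (t f) = t D_(m+1) f + D_m f] for divided derivatives. It survives modulo
    [t^q] because the binomials make [D_(m+1) (t^q)] vanish. *)
Lemma jordan_divder q m : (forall l, (0 < l < q)%N -> 'C(q, l)%:R = 0 :> k) ->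
  (m.+1 < q)%N ->
  jordan_mx q *m divder q m.+1 = divder q m.+1 *m jordan_mx q + divder q m.
Proof.
move=> binq mq; apply/matrixP => i l; rewrite [RHS]mxE.
(* By Pascal's rule the right side is the coefficient of [t^l] in [D_(m+1) (t^(i+1))]. *)
have -> : (divder q m.+1 *m jordan_mx q) i l + divder q m i l =
    ('C(i.+1, l) * (l + m.+1 == i.+1))%N%:R.
  rewrite addnS eqSS [divder _ _ _ _]mxE.
  case: (posnP l) => l0; first by rewrite mul_jordan0 // add0r l0 !bin0.
  have l1 : (l.-1 < q)%N by apply: leq_ltn_trans (leq_pred _) _.
  rewrite (@mul_jordanE _ _ _ _ _ (Ordinal l1)) /= ?prednK // mxE /= addnS -addSn prednK //.
  rewrite -natrD -mulnDl; congr (_ * _)%N%:R.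
  by rewrite -[in RHS](prednK l0) binS prednK // addnC.
case: (ltngtP i.+1 q) (ltn_ord i) => // [iq|iq] _.
  by rewrite (@jordan_mulE _ _ _ i (Ordinal iq)) // mxE.
rewrite jordan_mul_last // iq; case: eqP => lmq; rewrite /= ?muln0 ?muln1 ?binq // ltn_ord andbT.
by case: posnP lmq => // -> h; rewrite -h ltnn in mq.
Qed.

(** Each entry is fed by a single [m], which collapses sums over [m]. When [i < l], truncated
    subtraction is harmless since the binomial is 0. *)
Lemma divder_lower q m (i l : 'I_q) :
  divder q m i l = if m == (i - l)%N then 'C(i, l)%:R else 0.
Proof.
rewrite mxE; have [li|il] := leqP l i; last by rewrite bin_small //; case: ifP.
by rewrite -(eqn_add2l l m) subnKC //; case: eqP => _; rewrite ?muln1 ?muln0.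
Qed.

(* Since A ^+ q = 0 and (t + A) ^+ q = t ^ q + A ^+ q, the substitution
   t |-> t + A is an automorphism of k[A][t]/(t^q) turning multiplication by t
   into multiplication by t + A; [P] below is its Taylor expansion. *)
Lemma jordan_tens_iso q (V : nilpEndo k) : (0 < q)%N ->
  (forall l, (0 < l < q)%N -> 'C(q, l)%:R = 0 :> k) -> ne_mx V ^+ q = 0 ->
  ne_iso (ne_tens (jordan q) (ne_zero (ne_dim V))) (ne_tens (jordan q) V).
Proof.
case: q => // q _ binq; case: V => n A nA /= Aq0.
pose P : 'M[k]_(q.+1 * n) := \sum_(m < q.+1) tensmx (divder q.+1 m) (A ^+ m).
have PE i a l b : P (mxtens_index (i, a)) (mxtens_index (l, b)) =
    'C(i, l)%:R * (A ^+ (i - l)) a b.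
  have ilq : (i - l < q.+1)%N by rewrite (leq_ltn_trans (leq_subr _ _)).
  rewrite summxE (bigD1 (Ordinal ilq)) //= tensmxE divder_lower eqxx big1 ?addr0 //.
  by move=> m; rewrite -val_eqE /= tensmxE divder_lower => /negPf->; rewrite mul0r.
(* Pairs are numbered lexicographically, so [P] is block lower triangular with identity diagonal
   blocks [A ^+ 0]. *)
have detP : \det P = 1.
  rewrite det_trig; last first.
    apply/is_trig_mxP => r s; case: (mxtens_indexP r) => i a.
    case: (mxtens_indexP s) => l b /= rs; rewrite PE.
    have [il|li] := ltnP i l; first by rewrite bin_small // mul0r.
    have {li}il : i = l.
      apply/val_inj/eqP; rewrite eqn_leq li andbT leqNgt; apply/negP => li'.
      have : (l.+1 * n <= i * n)%N by rewrite leq_mul2r li' orbT.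
      rewrite mulSn leqNgt => /negP; apply.
      apply: leq_ltn_trans (leq_addr a _) (ltn_trans rs _).
      by rewrite addnC ltn_add2r.
    subst l; rewrite ltn_add2l in rs.
    by rewrite subnn mxE -val_eqE ltn_eqF // mulr0.
  apply: big1 => r _; case: (mxtens_indexP r) => i a.
  by rewrite PE binn subnn mxE eqxx mul1r.
have Pu : P \in unitmx by rewrite unitmxE detP unitr1.
rewrite /ne_iso; exists P, (invmx P); rewrite mulmxV // mulVmx //; split=> //=.
rewrite /tens_mx /= tensmx0 addr0 mulmxDr !mulmx_suml !mulmx_sumr.
under eq_bigr do rewrite tensmx_mul mul1mx.
under [in RHS]eq_bigr do rewrite tensmx_mul mulmx1.
under [X in _ = _ + X]eq_bigr do rewrite tensmx_mul mulmx1 mulmxE -exprSr.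
(* The [A ^+ m.+1] term on the left is matched with the two such terms on the right; the leftover
   top term contains [A ^+ q.+1 = 0]. *)
rewrite [LHS]big_ord_recl [X in _ = X + _]big_ord_recl [X in _ = _ + X]big_ord_recr /=.
rewrite Aq0 tensmx0 addr0 divder0 mulmx1 mul1mx -addrA; congr (_ + _).
rewrite -big_split /=; apply: eq_bigr => m _.
rewrite jordan_divder ?ltnS //.
by apply/matrixP => r s; rewrite !mxE mulrDl.
Qed.

Lemma conv_cls_jordan_mul q (V : nilpEndo k) : (0 < q)%N ->
  (forall l, (0 < l < q)%N -> 'C(q, l)%:R = 0 :> k) -> ne_mx V ^+ q = 0 ->
  conv_cls (jordan q) * conv_cls V = conv_cls (jordan q) *+ ne_dim V.
Proof.
move=> q0 binq Vq0; rewrite -conv_cls_tens -(conv_cls_iso (jordan_tens_iso q0 binq Vq0)).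
by rewrite conv_cls_tens conv_cls_zero mulr_natr.
Qed.

End Jordan.

(** * Orthogonal non-nilpotent elements from Jordan blocks of prime power size *)

Section PrimePowers.
Variables (p : nat) (k : fieldType).
Hypotheses (p_prime : prime p) (char_k : p \in [pchar k]).

(** In [l * 'C(p ^ n, l) = p ^ n * 'C(p ^ n - 1, l - 1)], a binomial prime to [p] would force
    [p ^ n] to divide [l]. *)
Lemma bin_prime_expn n l : (0 < l < p ^ n)%N -> 'C(p ^ n, l)%:R = 0 :> k.
Proof.
case: l => // l /= lq; apply/eqP; rewrite -(dvdn_pcharf char_k).
apply: contraLR lq; rewrite -prime_coprime // -leqNgt => cop.
apply: dvdn_leq => //; rewrite -(@Gauss_dvdl _ _ 'C(p ^ n, l.+1)) ?coprimeXl //.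
by rewrite -mul_bin_diag dvdn_mulr.
Qed.

Local Notation y n := (conv_cls (jordan k (p ^ n))).

Lemma mul_jordan_prime m n : (m <= n)%N -> y m * y n = y n *+ p ^ m.
Proof.
move=> mn; have pn0 i : (0 < p ^ i)%N by rewrite expn_gt0 prime_gt0.
rewrite mulrC conv_cls_jordan_mul //; first exact: bin_prime_expn.
by rewrite -(subnKC mn) expnD exprM /= jordan_expr0 expr0n eqn0Ngt pn0.
Qed.

(* p ^ (n + 1) times the difference of the idempotents y n / p ^ n and
   y n.+1 / p ^ n.+1. *)
Definition jordan_diff n : convRing k := y n *+ p - y n.+1.

(** [jordan_diff m] kills every [y i] with [m < i], since both of its terms multiply [y i] by
    [p ^ m.+1]. *)
Lemma jordan_diff_mul m n : (m < n)%N -> jordan_diff m * jordan_diff n = 0.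
Proof.
move=> mn.
have E i : (m < i)%N -> jordan_diff m * y i = 0.
  move=> mi; rewrite mulrBl mulrnAl !mul_jordan_prime //; last exact: ltnW.
  by rewrite -mulrnA -expnSr subrr.
by rewrite mulrBr mulrnAr !E ?mul0rn ?subrr // ltnS ltnW.
Qed.

Lemma jordan_diff_sqr n : jordan_diff n * jordan_diff n = jordan_diff n *+ p ^ n.+1.
Proof.
rewrite {2}/jordan_diff mulrBr mulrnAr.
have -> : jordan_diff n * y n.+1 = 0.
  by rewrite mulrBl mulrnAl !mul_jordan_prime // -mulrnA -expnSr subrr.
rewrite subr0 mulrBl mulrnAl [y n.+1 * _]mulrC !mul_jordan_prime //.
by rewrite -mulrnA mulnC mulrnA -mulrnBl -mulrnA -expnSr.
Qed.

Lemma jordan_diff_nonnilp n j : jordan_diff n ^+ j <> 0.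
Proof.
move=> xj0; have pgt0 := prime_gt0 p_prime.
have E i : jordan_diff n ^+ i.+1 = jordan_diff n *+ (p ^ n.+1) ^ i.
  elim: i => [|i IH]; first by rewrite expr1.
  by rewrite exprS IH mulrnAr jordan_diff_sqr -mulrnA -expnS.
(* Nilpotency would make a multiple of [y n *+ p] equal to the same multiple of [y n.+1]; the rank
   of the [p ^ n]-th power is 0 on the first block only. *)
have := E j; rewrite exprS xj0 mulr0 => /esym/eqP.
rewrite mulrnBl subr_eq0 -mulrnA => /eqP /(conv_cls_rank (p ^ n)).
rewrite jordan_expr0 mxrank0 mul0n => /esym/eqP.
rewrite muln_eq0 !expn_eq0 (gtn_eqF pgt0) /= orbF mxrank_eq0 => /eqP.
have lt0 : (0 < p ^ n.+1)%N by rewrite expn_gt0 pgt0.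
have lt1 : (p ^ n < p ^ n.+1)%N by rewrite ltn_exp2l ?prime_gt1.
(* The entry at row 0 and column [p ^ n] of this power is 1. *)
move=> /matrixP /(_ (Ordinal lt0) (Ordinal lt1)) /eqP.
by rewrite jordan_exprE mxE add0n eqxx oner_eq0.
Qed.

End PrimePowers.

Theorem theorem4p8 (p : nat) (k : fieldType)
    (p_prime : prime p) (char_k : p \in [pchar k]%R) :
  infinite_set [set Z : set (Spec (convRing k)) | irreducible_component Z]%classic
  /\ ~ noetherian (convRing k).
Proof.
have orth m n : (m < n)%N -> jordan_diff p k m * jordan_diff p k n = 0.
  exact: jordan_diff_mul.
have nonnilp := jordan_diff_nonnilp p_prime char_k.
split; first exact: (orthogonal_infinite_components orth nonnilp).
exact: (orthogonal_not_noetherian orth nonnilp).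
Qed.
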